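(* Let $\mathcal{E}$ be a finite dimensional Hilbert space and let $T\in B(\mathcal{E})$ be of defect form with $\dim E_1(T)=\dim E_{-1}(T)$. Suppose $T$ has at least two distinct positive eigenvalues. Then there exists an irreducible BCL pair $(V_1,V_2)$ on $H^2_{\mathcal{E}}(\mathbb{D})$ whose defect operator has non-zero part equal to $T$; that is, there exist a unitary $U$ and a projection $P$ on $\mathcal{E}$ with no common reducing subspace other than $\{0\}$ and $\mathcal{E}$ such that $P^\perp-UP^\perp U^*=T$.
   Context: All Hilbert spaces are complex and separable; ''projection'' means orthogonal projection and $P^\perp=I-P$. $H^2(\mathbb{D})$ is the Hardy space of the open unit disc, $M_z$ is multiplication by $z$, $P_{\mathbb{C}}$ is the projection of $H^2(\mathbb{D})$ onto the constants, and $H^2_{\mathcal{E}}(\mathbb{D})$ is identified with $H^2(\mathbb{D})\otimes\mathcal{E}$. A BCL triple is $(\mathcal{E},U,P)$ with $U$ unitary and $P$ a projection on $\mathcal{E}$; its BCL pair is $V_1=(I\otimes P+M_z\otimes P^\perp)(I\otimes U^* )$, $V_2=(I\otimes U)(M_z\otimes P+I\otimes P^\perp)$. The BCL pair is irreducible if $U$ and $P$ have no common reducing subspace other than $\{0\}$ and $\mathcal{E}$. The defect operator is $C(V_1,V_2)=I-V_1V_1^*-V_2V_2^*+V_1V_2V_1^*V_2^*=P_{\mathbb{C}}\otimes(P^\perp-UP^\perp U^* )$; ''its non-zero part equals $T$'' means $\overline{\operatorname{ran}}\,C(V_1,V_2)=\mathbb{C}\otimes\mathcal{E}$ and $C(V_1,V_2)|_{\mathbb{C}\otimes\mathcal{E}}=T$,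 i.e. $P^\perp-UP^\perp U^*=T$. $E_\mu(T)=\ker(T-\mu I)$. $T\in B(\mathcal{E})$ is of defect form if $T$ is compact, self-adjoint, injective, $\|T\|\le1$, and for every $\lambda\in(0,1)$, $\lambda$ is an eigenvalue of $T$ iff $-\lambda$ is, with $\dim E_\lambda(T)=\dim E_{-\lambda}(T)$ (eigenvalues $\pm1$ may or may not occur). Positive eigenvalues may include $1$. *)

(* Defs.v *)
(* A finite-dimensional complex Hilbert space E of dimension n
   is modelled as the column vectors 'cV[R[i]]_n over the complex numbers
   R[i] = complex R of an arbitrary R : realType, with the standard inner
   product; B(E) is 'M[R[i]]_n acting on column vectors by A *m v. *)
From HB Require Import structures.
From mathcomp Require Import all_boot all_algebra.
From mathcomp Require Import reals complex.
Set Implicit Arguments. Unset Strict Implicit. Unset Printing Implicit Defensive.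
Import GRing.Theory Num.Theory.
Local Open Scope ring_scope.

Section Defs.
Variable R : realType.
Local Notation C := (R[i]).
Variable n : nat.

Definition adj m p (A : 'M[C]_(m, p)) : 'M[C]_(p, m) := (map_mx Num.conj A)^T.

Definition unitary_mx (U : 'M[C]_n) : Prop :=
  U *m adj U = 1%:M /\ adj U *m U = 1%:M.

Definition orth_projection (P : 'M[C]_n) : Prop :=
  P *m P = P /\ adj P = P.

Definition perp (P : 'M[C]_n) : 'M[C]_n := 1%:M - P.

(* A subspace M of E is encoded by a matrix W whose rows are the (transposed)
   vectors spanning M (mxalgebra row space).  M is invariant under X (acting on
   column vectors) iff  W *m X^T <= W. *)
Definition invariant (W : 'M[C]_n) (X : 'M[C]_n) : bool := stablemx W X^T.

Definition reducing (W : 'M[C]_n) (X : 'M[C]_n) : bool :=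
  invariant W X && invariant W (adj X).

Definition no_common_reducing (U P : 'M[C]_n) : Prop :=
  forall W : 'M[C]_n, reducing W U -> reducing W P ->
    (W == (0 : 'M[C]_n))%MS || (W == 1%:M)%MS.

(* E_mu(T) = ker (T - mu I), as a row-space matrix (rows = transposed vectors) *)
Definition eigenspace (T : 'M[C]_n) (mu : C) : 'M[C]_n :=
  kermx (T - mu%:M)^T.

Definition Edim (T : 'M[C]_n) (mu : C) : nat := \rank (eigenspace T mu).

Definition is_eigenvalue (T : 'M[C]_n) (mu : C) : Prop :=
  exists2 v : 'cV[C]_n, v != 0 & T *m v = mu *: v.

Definition nsq (v : 'cV[C]_n) : C := (adj v *m v) 0 0.

(* Defect form.  Compactness is automatic in finite dimension. *)
Definition defect_form (T : 'M[C]_n) : Prop :=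
  [/\ adj T = T,
      (forall v : 'cV[C]_n, T *m v = 0 -> v = 0),
      (forall v : 'cV[C]_n, nsq (T *m v) <= nsq v)
    & (forall lam : C, 0 < lam < 1 ->
         (is_eigenvalue T lam <-> is_eigenvalue T (- lam)) /\
         Edim T lam = Edim T (- lam))].

End Defs.

(* Main.v *)
(* Diagonalise T with eigenvalues l_i and - l_i (i < m), where l_0 < 1, and put
   s_i = sqrt (1 - l_i^2).  Each 2-plane spanned by eigenvectors for l_i and
   - l_i carries two lines, spanned by unit vectors q_i and q'_i with
   <q_i, q'_i> = s_i, whose projections differ by diag(l_i, - l_i); let r_i and
   r'_i span their complements in the plane.  Let Q = P^perp be the projection
   onto the span of the q_i, and let U map q_0 to - q'_0, q_i to q'_i for i > 0,
   and r_i to r'_(i+1) cyclically.  Then Q - U Q U^* = T.  The compression Q U Q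
   is diag(- s_0, s_1, ..., s_(m-1)) on ran Q, so - s_0 <> 0 is a simple
   eigenvalue of it, and a reducing subspace contains q_0 or is orthogonal to
   it.  As <q_i, r'_i> and <r_i, q'_i> are +- l_i <> 0, applying U, Q and 1 - Q
   to q_0 yields r_0, then q_1, r_1, q_2, ..., so a reducing subspace containing
   q_0 is everything; otherwise this applies to its orthogonal complement. *)
Require Import Defs.
From HB Require Import structures.
From mathcomp Require Import all_boot all_order all_fingroup all_algebra.
From mathcomp Require Import reals complex spectral ring.
Import Order.TTheory GRing.Theory Num.Theory.
Local Open Scope ring_scope.

Set Implicit Arguments.
Unset Strict Implicit.
Unset Printing Implicit Defensive.

(** * Adjoints and real diagonal matrices *)

Definition adjmx (C : numClosedFieldType) m n (A : 'M[C]_(m, n)) :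
  'M[C]_(n, m) := (map_mx Num.conj A)^T.

Lemma adjmxM (C : numClosedFieldType) m n p (A : 'M[C]_(m, n))
    (B : 'M[C]_(n, p)) :
  adjmx (A *m B) = adjmx B *m adjmx A.
Proof. by rewrite /adjmx map_mxM trmx_mul. Qed.

Lemma adjmxK (C : numClosedFieldType) m n (A : 'M[C]_(m, n)) :
  adjmx (adjmx A) = A.
Proof. by apply/matrixP => i j; rewrite !mxE conjCK. Qed.

Lemma adjmx1 (C : numClosedFieldType) n : adjmx 1%:M = 1%:M :> 'M[C]_n.
Proof. by rewrite /adjmx map_mx1 trmx1. Qed.

Lemma adjmx0 (C : numClosedFieldType) m n : adjmx 0 = 0 :> 'M[C]_(m, n).
Proof. by rewrite /adjmx map_mx0 trmx0. Qed.

Lemma adjmxN (C : numClosedFieldType) m n (A : 'M[C]_(m, n)) :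
  adjmx (- A) = - adjmx A.
Proof. by rewrite /adjmx map_mxN linearN. Qed.

Lemma adjmxB (C : numClosedFieldType) m n (A B : 'M[C]_(m, n)) :
  adjmx (A - B) = adjmx A - adjmx B.
Proof. by rewrite /adjmx map_mxB linearB. Qed.

Lemma tr_adjmx (C : numClosedFieldType) m n (A : 'M[C]_(m, n)) :
  (adjmx A)^T = adjmx A^T.
Proof. by rewrite /adjmx map_trmx. Qed.

Lemma adjmx_block (C : numClosedFieldType) m1 m2 n1 n2 (A : 'M[C]_(m1, n1))
    (B : 'M[C]_(m1, n2)) (A' : 'M[C]_(m2, n1)) (B' : 'M[C]_(m2, n2)) :
  adjmx (block_mx A B A' B')
  = block_mx (adjmx A) (adjmx A') (adjmx B) (adjmx B').
Proof. by rewrite /adjmx map_block_mx tr_block_mx. Qed.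

Definition dmx (C : numClosedFieldType) m (f : 'I_m -> C) : 'M[C]_m :=
  diag_mx (\row_i f i).

Lemma dmx_eq (C : numClosedFieldType) m (f g : 'I_m -> C) :
  f =1 g -> dmx f = dmx g.
Proof. by move=> fg; congr diag_mx; apply/rowP => i; rewrite !mxE. Qed.

Lemma dmxM (C : numClosedFieldType) m (f g : 'I_m -> C) :
  dmx f *m dmx g = dmx (fun i => f i * g i).
Proof. by rewrite mulmx_diag; congr diag_mx; apply/rowP => i; rewrite !mxE. Qed.

Lemma dmxD (C : numClosedFieldType) m (f g : 'I_m -> C) :
  dmx f + dmx g = dmx (fun i => f i + g i).
Proof. by rewrite -raddfD; congr diag_mx; apply/rowP => i; rewrite !mxE. Qed.

Lemma dmxN (C : numClosedFieldType) m (f : 'I_m -> C) :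
  - dmx f = dmx (fun i => - f i).
Proof. by rewrite -raddfN; congr diag_mx; apply/rowP => i; rewrite !mxE. Qed.

Lemma dmx_tr (C : numClosedFieldType) m (f : 'I_m -> C) : (dmx f)^T = dmx f.
Proof. exact: tr_diag_mx. Qed.

Lemma adjmx_dmx (C : numClosedFieldType) m (f : 'I_m -> C) :
  (forall i, f i \is Num.real) -> adjmx (dmx f) = dmx f.
Proof.
move=> fR; rewrite /adjmx /dmx map_diag_mx tr_diag_mx; congr diag_mx.
by apply/rowP => i; rewrite !mxE; apply: conj_Creal.
Qed.

Lemma dmx1 (C : numClosedFieldType) m : dmx (fun=> 1) = 1%:M :> 'M[C]_m.
Proof. by apply/matrixP => i j; rewrite !mxE. Qed.

Lemma dmx0 (C : numClosedFieldType) m : dmx (fun=> 0) = 0 :> 'M[C]_m.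
Proof. by apply/matrixP => i j; rewrite !mxE mul0rn. Qed.

Lemma delta_dmx (C : numClosedFieldType) m (f : 'I_m -> C) i :
  delta_mx 0 i *m dmx f = f i *: delta_mx 0 i :> 'rV_m.
Proof.
rewrite mul_mx_diag; apply/rowP => j; rewrite !mxE eqxx /= mulrC.
by case: eqP => [->|]; rewrite ?mulr0.
Qed.

Lemma delta_perm_mx (F : pzSemiRingType) m (g : 'S_m) i :
  delta_mx 0 i *m perm_mx g = delta_mx 0 (g i) :> 'rV[F]_m.
Proof. by rewrite -rowE; apply/rowP => j; rewrite !mxE eq_sym. Qed.

Lemma submx_stable (F : fieldType) m n (W X : 'M[F]_n) (x : 'M[F]_(m, n)) :
  stablemx W X -> (x <= W)%MS -> (x *m X <= W)%MS.
Proof. by move=> sW xW; apply: submx_trans sW; apply: submxMr. Qed.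

(** * Irreducibility and the model pair *)

Definition irreducible_pair (C : numClosedFieldType) n (U P : 'M[C]_n) : Prop :=
  forall W : 'M[C]_n,
  [/\ stablemx W U^T, stablemx W (adjmx U)^T, stablemx W P^T
     & stablemx W (adjmx P)^T] ->
  W = 0 \/ (1%:M <= W)%MS.

(* Coordinates are taken in the orthonormal basis q_0, ..., q_k, r_0, ..., r_k
   of the header, so that [model_rot] maps it to q'_0, ..., r'_k. *)
Section Model.
Variables (C : numClosedFieldType) (k : nat) (s l : 'I_k.+1 -> C).

(** Because of the transpose, the column basis vector of index [i] goes to that of index
    [ordS i]. *)
Definition shift_mx : 'M[C]_k.+1 := (perm_mx (perm (@ordS_inj k.+1)))^T.

Definition refl_sign (i : 'I_k.+1) : C := if i == ord0 then -1 else 1.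

(** The columns are q'_i = s_i q_i - l_i r_i and r'_i = l_i q_i + s_i r_i: a rotation in each plane
    once s_i^2 + l_i^2 = 1. *)
Definition model_rot : 'M[C]_(k.+1 + k.+1) :=
  block_mx (dmx s) (dmx l) (- dmx l) (dmx s).

Definition model_U : 'M[C]_(k.+1 + k.+1) :=
  model_rot *m block_mx (dmx refl_sign) 0 0 shift_mx.

Definition model_Q : 'M[C]_(k.+1 + k.+1) := block_mx 1%:M 0 0 0.

Lemma model_U_tr :
  model_U^T = block_mx (dmx refl_sign) 0 0 shift_mx^T
              *m block_mx (dmx s) (- dmx l) (dmx l) (dmx s).
Proof.
by rewrite trmx_mul !tr_block_mx linearN /= !dmx_tr !trmx0.
Qed.

Lemma model_Q_tr : model_Q^T = model_Q.
Proof. by rewrite tr_block_mx trmx1 !trmx0. Qed.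

Lemma model_perpE : (1%:M - model_Q) = block_mx 0 0 0 1%:M.
Proof.
by rewrite scalar_mx_block opp_block_mx add_block_mx !subr0 subrr.
Qed.

Let q j : 'rV[C]_(k.+1 + k.+1) := row_mx (delta_mx 0 j) 0.
Let r j : 'rV[C]_(k.+1 + k.+1) := row_mx 0 (delta_mx 0 j).

Hypothesis l0 : forall i, l i != 0.

Lemma model_cyclic (W : 'M[C]_(k.+1 + k.+1)) :
  stablemx W model_U^T -> stablemx W model_Q ->
  (q ord0 <= W)%MS -> (1%:M <= W)%MS.
Proof.
move=> sU sQ q0W.
have sQ' : stablemx W (1%:M - model_Q).
  by rewrite stablemxD ?stablemxC // stablemxN.
(* Row vectors are acted on by [model_U^T]. The image of q_j is +- q'_j, and its component outside
   ran Q is +- l_j r_j with l_j nonzero. *)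
have qr j : (q j <= W)%MS -> (r j <= W)%MS.
  move=> qW; have := submx_stable sQ' (submx_stable sU qW).
  rewrite model_U_tr model_perpE !mulmxA mul_row_block !mul0mx !addr0 mulmx0.
  rewrite mul_row_block !mul0mx !addr0 mul_row_block !mulmx0 addr0 add0r mulmx1.
  rewrite delta_dmx -scalemxAl mulmxN delta_dmx !scalerN scalerA -scaleNr.
  rewrite -[X in row_mx X](scaler0 _ (- (refl_sign j * l j))) -scale_row_mx.
  rewrite eqmx_scale // oppr_eq0 mulf_neq0 // /refl_sign.
  by case: ifP; rewrite ?oppr_eq0 oner_eq0.
(* Here r_j goes to r'_(j+1), whose component in ran Q is l_(j+1) q_(j+1). *)
have rq j : (r j <= W)%MS -> (q (ordS j) <= W)%MS.
  move=> rW; have := submx_stable sQ (submx_stable sU rW).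
  rewrite model_U_tr !mulmxA mul_row_block !mul0mx !add0r mulmx0.
  rewrite mul_row_block !mul0mx !add0r mul_row_block !mulmx0 !addr0 mulmx1.
  rewrite trmxK delta_perm_mx permE delta_dmx.
  rewrite -[X in row_mx _ X](scaler0 _ (l (ordS j))).
  by rewrite -scale_row_mx eqmx_scale.
have qW j : (q j <= W)%MS.
  case: j => j; elim: j => [|j IHj] jk.
    by congr (q _ <= W)%MS: q0W; apply: val_inj.
  have /qr/rq := IHj (ltnW jk).
  by congr (q _ <= W)%MS; apply: val_inj; rewrite /= modn_small.
apply/row_subP => i; rewrite row1; case: (splitP i) => j ij.
  have -> : i = lshift k.+1 j by apply: val_inj.
  by rewrite delta_mx_lshift; apply: qW.
have -> : i = rshift k.+1 j by apply: val_inj.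
by rewrite delta_mx_rshift; apply/qr/qW.
Qed.

Hypothesis s_ge0 : forall i, 0 <= s i.
Hypothesis s0_gt0 : 0 < s ord0.

Lemma model_compression :
  model_Q *m model_U^T *m model_Q
  = diag_mx (row_mx (\row_i (refl_sign i * s i)) 0).
Proof.
rewrite model_U_tr !mulmx_block !(mul0mx, mulmx0, addr0, mul1mx, mulmx1).
by rewrite dmxM diag_mx_row raddf0.
Qed.

(* The eigenvalue [- s ord0] of the compression of [U] to [ran Q] is simple, so
   a polynomial in the compression is a multiple of the projection onto its
   eigenvector. *)
Lemma model_dichotomy (W : 'M[C]_(k.+1 + k.+1)) :
  stablemx W model_U^T -> stablemx W model_Q ->
  (q ord0 <= W)%MS \/ W *m (q ord0)^T = 0.
Proof.
move=> sU sQ.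
have /horner_mx_stable sK :
    stablemx W (diag_mx (row_mx (\row_i (refl_sign i * s i)) 0)).
  by rewrite -model_compression !stablemxM.
(* The factor ['X] kills ran (1 - Q), and the others kill q_i for i > 0. All roots are nonnegative,
   so none of them is - s_0 < 0. *)
pose p : {poly C} := 'X * \prod_(i < k.+1 | i != ord0) ('X - (s i)%:P).
have p0 : p.[- s ord0] != 0.
  rewrite hornerM hornerX mulf_neq0 ?oppr_eq0 ?(gt_eqF s0_gt0) // horner_prod.
  apply/prodf_neq0 => i _; rewrite hornerXsubC -opprD oppr_eq0 gt_eqF //.
  exact: ltr_wpDr.
have pd : map_mx (horner p) (row_mx (\row_i (refl_sign i * s i)) 0)
    = p.[- s ord0] *: q ord0.
  rewrite map_row_mx scale_row_mx scaler0; congr row_mx; apply/rowP => i.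
    rewrite !mxE eqxx /refl_sign /=; have [->|i0] := eqVneq.
      by rewrite mulN1r mulr1.
    rewrite mul1r mulr0 hornerM horner_prod (bigD1 i) //= hornerXsubC subrr.
    by rewrite mul0r mulr0.
  by rewrite !mxE hornerM hornerX mul0r.
have := sK p; rewrite horner_mx_diag pd => {}sK.
(* If some row of [W] has a nonzero coordinate along q_0, the polynomial sends that row to a nonzero
   multiple of q_0. *)
have [W0|W0] := eqVneq (W *m (q ord0)^T) 0; [by right|left].
have /cV0Pn [i Wi] := W0.
have Wi0 : (W *m (q ord0)^T) i 0 = W i (lshift _ ord0).
  by rewrite /q -delta_mx_lshift trmx_delta -colE mxE.
have := submx_trans (row_sub i _) sK; rewrite row_mul.
have -> : row i W *m diag_mx (p.[- s ord0] *: q ord0)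
    = (W i (lshift _ ord0) * p.[- s ord0]) *: q ord0.
  rewrite mul_mx_diag; apply/rowP => j; rewrite /q -delta_mx_lshift.
  rewrite !mxE eqxx /=.
  by case: eqP => [->|]; rewrite ?mulr0 // !mulr1.
by rewrite eqmx_scale // mulf_neq0 // -Wi0.
Qed.


Lemma model_irreducible : irreducible_pair model_U (1%:M - model_Q).
Proof.
move=> W [sU sU' sP _].
have trP : (1%:M - model_Q)^T = 1%:M - model_Q.
  by rewrite linearB /= trmx1 model_Q_tr.
rewrite trP in sP.
have sQ : stablemx W model_Q.
  by rewrite -[model_Q](subKr 1%:M) stablemxD ?stablemxC // stablemxN.
have [q0W|q0W] := model_dichotomy sU sQ.
  by right; apply: model_cyclic.
(* [M] is the orthogonal complement of [W]. *)
pose M : 'M_(k.+1 + k.+1) := kermx (adjmx W).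
(* Taking adjoints in [W *m (adjmx X)^T = Z *m W] gives [X^T *m adjmx W = adjmx W *m adjmx Z], which
   [M] annihilates from the left. *)
have stM (X : 'M_(k.+1 + k.+1)) : stablemx W (adjmx X)^T -> stablemx M X^T.
  move=> /submxP[Z WZ]; apply/sub_kermxP.
  rewrite -mulmxA -[X^T]adjmxK -adjmxM -tr_adjmx WZ adjmxM mulmxA mulmx_ker.
  exact: mul0mx.
have M1 : (1%:M <= M)%MS.
  apply: model_cyclic; first exact: stM.
    rewrite -model_Q_tr; apply: stM.
    rewrite /model_Q adjmx_block adjmx1 !adjmx0.
    by rewrite -/model_Q model_Q_tr.
  apply/sub_kermxP; rewrite -[LHS]adjmxK adjmxM adjmxK.
  have -> : adjmx (q ord0) = (q ord0)^T.
    rewrite /q -delta_mx_lshift; apply/colP => i; rewrite !mxE rmorph_nat //.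
  by rewrite q0W adjmx0.
left.
have : adjmx W = 0 by rewrite -[LHS]mul1mx; apply/sub_kermxP.
by move/(congr1 (@adjmx C _ _)); rewrite adjmxK adjmx0 => ->.
Qed.

Hypothesis l_real : forall i, l i \is Num.real.
Hypothesis sl : forall i, s i ^+ 2 + l i ^+ 2 = 1.

Lemma model_unitary : model_U *m adjmx model_U = 1%:M.
Proof.
rewrite /model_U adjmxM mulmxA -[X in X *m _]mulmxA.
have s_real i : s i \is Num.real by apply: ger0_real.
have e_real i : refl_sign i \is Num.real.
  by rewrite /refl_sign; case: ifP; rewrite ?rpredN ?rpred1.
have -> : block_mx (dmx refl_sign) 0 0 shift_mx *m
          adjmx (block_mx (dmx refl_sign) 0 0 shift_mx) = 1%:M.
  rewrite adjmx_block !adjmx0 adjmx_dmx // mulmx_block.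
  rewrite !(mul0mx, mulmx0, addr0, add0r).
  rewrite dmxM [RHS]scalar_mx_block; congr block_mx.
    rewrite -dmx1; apply: dmx_eq => i; rewrite /refl_sign.
    by case: ifP; rewrite ?mulrNN mulr1.
  rewrite /shift_mx /adjmx map_trmx trmxK map_perm_mx tr_perm_mx -perm_mxM.
  by rewrite mulVg perm_mx1.
rewrite mulmx1 /model_rot adjmx_block adjmxN !adjmx_dmx // mulmx_block.
rewrite [RHS]scalar_mx_block !(mulmxN, mulNmx, opprK) !dmxM !dmxN !dmxD.
rewrite -dmx1 -dmx0.
by congr block_mx; apply: dmx_eq => i /=; rewrite -?(sl i); ring.
Qed.

(** The sign change and the shift preserve ran Q and its complement, so they drop out of U Q U^* and
    only the rotation contributes. This is what leaves them free to be chosen for irreducibility. *)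
Lemma model_defect :
  model_Q - model_U *m model_Q *m adjmx model_U =
  block_mx (dmx (fun i => l i ^+ 2)) (dmx (fun i => s i * l i))
           (dmx (fun i => s i * l i)) (dmx (fun i => - l i ^+ 2)).
Proof.
have s_real i : s i \is Num.real by apply: ger0_real.
have e_real i : refl_sign i \is Num.real.
  by rewrite /refl_sign; case: ifP; rewrite ?rpredN ?rpred1.
have EQE : block_mx (dmx refl_sign) 0 0 shift_mx *m model_Q *m
           adjmx (block_mx (dmx refl_sign) 0 0 shift_mx) = model_Q.
  rewrite /model_Q adjmx_block !adjmx0 adjmx_dmx // !mulmx_block.
  rewrite !(mul0mx, mulmx0, addr0, mulmx1) dmxM -dmx1.
  congr block_mx; apply: dmx_eq => i; rewrite /refl_sign.
  by case: ifP; rewrite ?mulrNN mulr1.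
have -> : model_U *m model_Q *m adjmx model_U
        = model_rot *m model_Q *m adjmx model_rot.
  by rewrite /model_U adjmxM -[in RHS]EQE !mulmxA.
rewrite /model_rot /model_Q adjmx_block adjmxN !adjmx_dmx // !mulmx_block.
rewrite !(mul0mx, mulmx0, addr0, mulmx1) !(mulmxN, mulNmx, dmxM, dmxN).
rewrite opp_block_mx add_block_mx -dmx1 !add0r !(dmxD, dmxN).
by congr block_mx; apply: dmx_eq => i /=; rewrite -?(sl i); ring.
Qed.

End Model.

(* For [x = cos t] with [0 <= t < pi / 2], the numbers [half_cos x],
   [half_sin x] and [double_sin x] are [cos (t / 2)], [sin (t / 2)] and
   [sin t]. *)
Section HalfAngle.
Variables (C : numClosedFieldType) (x : C).
Hypothesis x01 : 0 < x <= 1.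

Definition half_cos : C := sqrtC ((1 + x) / 2).
Definition half_sin : C := sqrtC ((1 - x) / 2).

Lemma half_cos_ge0 : 0 <= half_cos.
Proof.
by case/andP: x01 => x0 _; rewrite sqrtC_ge0 divr_ge0 ?addr_ge0 ?ler01 ?ltW.
Qed.

Lemma half_sin_ge0 : 0 <= half_sin.
Proof. by case/andP: x01 => _ x1; rewrite sqrtC_ge0 divr_ge0 ?subr_ge0. Qed.

Lemma half_cos_sq : half_cos ^+ 2 = (1 + x) / 2.
Proof. exact: sqrtCK. Qed.

Lemma half_sin_sq : half_sin ^+ 2 = (1 - x) / 2.
Proof. exact: sqrtCK. Qed.

End HalfAngle.

Lemma cos_sin_half_sq (C : numClosedFieldType) (x : C) :
  half_cos x ^+ 2 + half_sin x ^+ 2 = 1.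
Proof. by rewrite half_cos_sq half_sin_sq; field. Qed.

Lemma cosB_sin_half_sq (C : numClosedFieldType) (x : C) :
  half_cos x ^+ 2 - half_sin x ^+ 2 = x.
Proof. by rewrite half_cos_sq half_sin_sq; field. Qed.

Definition double_sin (C : numClosedFieldType) (x : C) : C :=
  2 * half_cos x * half_sin x.

Lemma double_sin_sq (C : numClosedFieldType) (x : C) :
  double_sin x ^+ 2 + x ^+ 2 = 1.
Proof.
by rewrite /double_sin !exprMn half_cos_sq half_sin_sq; field.
Qed.

Lemma double_sin_ge0 (C : numClosedFieldType) (x : C) :
  0 < x <= 1 -> 0 <= double_sin x.
Proof.
by move=> x01; rewrite !mulr_ge0 ?(half_cos_ge0 x01) ?(half_sin_ge0 x01).
Qed.

Lemma double_sin_gt0 (C : numClosedFieldType) (x : C) :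
  0 < x < 1 -> 0 < double_sin x.
Proof.
case/andP=> x0 x1; rewrite !mulr_gt0 // sqrtC_gt0 divr_gt0 //.
  by rewrite addr_gt0.
by rewrite subr_gt0.
Qed.

(** * Unitary conjugation, diagonalisation and multiplicities *)

Section Conjugation.
Variable C : numClosedFieldType.

(** A subspace reducing the conjugated pair is carried by V^* to one reducing the original pair, and
    V carries the conclusion back. *)
Lemma irreducible_pair_conj n (V U P : 'M[C]_n) :
  V *m adjmx V = 1%:M -> irreducible_pair U P ->
  irreducible_pair (V *m U *m adjmx V) (V *m P *m adjmx V).
Proof.
move=> VV irr W [sU sU' sP sP'].
have VtV : V^T *m (adjmx V)^T = 1%:M.
  by rewrite -trmx_mul (mulmx1C VV) trmx1.
have VtV' : (adjmx V)^T *m V^T = 1%:M by rewrite -trmx_mul VV trmx1.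
have adjE X : adjmx (V *m X *m adjmx V) = V *m adjmx X *m adjmx V.
  by rewrite !adjmxM adjmxK mulmxA.
have st X : stablemx W (V *m X *m adjmx V)^T ->
    stablemx (W *m (adjmx V)^T) X^T.
  rewrite !trmx_mul => /submxMr-/(_ _ (adjmx V)^T).
  by rewrite -!mulmxA VtV mulmx1.
rewrite !adjE in sU' sP'.
have [|W0|W1] := irr (W *m (adjmx V)^T); first by split; apply: st.
  by left; rewrite -[W]mulmx1 -VtV' mulmxA W0 mul0mx.
right; have := submxMr V^T W1.
by rewrite mul1mx -mulmxA VtV' mulmx1 => /(mulmx_sub (adjmx V)^T); rewrite VtV'.
Qed.

Lemma diag_eigen n (T V : 'M[C]_n) (d : 'rV_n) mu :
  V *m adjmx V = 1%:M -> T = adjmx V *m diag_mx d *m V ->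
  (exists2 v : 'cV_n, v != 0 & T *m v = mu *: v) <-> exists i, d 0 i = mu.
Proof.
move=> VV TE; have VV' := mulmx1C VV; split=> [[v v0 Tv]|[i <-]].
  have : V *m v != 0.
    by apply: contra_neq v0 => v0; rewrite -[v]mul1mx -VV' -mulmxA v0 mulmx0.
  case/cV0Pn=> i vi; exists i; apply: (mulIf vi).
  have : diag_mx d *m (V *m v) = mu *: (V *m v).
    by rewrite scalemxAr -Tv TE !mulmxA VV mul1mx.
  by move/colP/(_ i); rewrite mul_diag_mx !mxE.
exists (adjmx V *m delta_mx i 0).
  apply/eqP => /(congr1 (mulmx V)); rewrite mulmxA VV mul1mx mulmx0.
  by move/colP/(_ i)/eqP; rewrite !mxE !eqxx oner_eq0.
rewrite TE -!mulmxA [V *m _]mulmxA VV mul1mx scalemxAr; congr (_ *m _).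
rewrite mul_diag_mx; apply/colP => j; rewrite !mxE.
by case: eqP => [->|]; rewrite ?mulr0.
Qed.

(** With [E] selecting the coordinates where [d] is nonzero, the matrix is [E^T *m D *m E], where
    [D] is invertible and [E] has full row rank; the rank is thus the size of [D]. *)
Lemma mxrank_diag n (d : 'rV[C]_n) :
  \rank (diag_mx d) = #|[pred i | d 0 i != 0]|.
Proof.
set A := [pred i | _].
pose E : 'M[C]_(#|A|, n) := \matrix_(h, j) (enum_val h == j)%:R.
pose D : 'M[C]_#|A| := diag_mx (\row_h d 0 (enum_val h)).
have dE : diag_mx d = E^T *m (D *m E).
  apply/matrixP => i j; rewrite mul_diag_mx !mxE.
  under eq_bigr do rewrite !mxE.
  rewrite -(big_enum_val (A := A)
    (fun k => (k == i)%:R * (d 0 k * (k == j)%:R))).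
  have [di|di] := eqVneq (d 0 i) 0.
    rewrite di mul0rn big1 // => k; rewrite inE.
    by have [->|] := eqVneq k i; rewrite ?di ?eqxx ?mul0r.
  rewrite (bigD1 i) //= eqxx mul1r big1 ?addr0 ?mulr_natr //.
  by move=> k /andP[_ /negPf ->]; rewrite mul0r.
have EE : E *m E^T = 1%:M.
  apply/matrixP => h h'; rewrite !mxE (bigD1 (enum_val h)) //= !mxE eqxx mul1r.
  rewrite (inj_eq enum_val_inj) eq_sym big1 ?addr0 // => k /negPf.
  by rewrite !mxE eq_sym => ->; rewrite mul0r.
have Efree : row_free E by apply/row_freeP; exists E^T.
have Dunit : D \in unitmx.
  rewrite unitmxE det_diag unitfE; apply/prodf_neq0 => h _; rewrite mxE.
  by have := enum_valP h; rewrite inE.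
rewrite dE mulmxA mxrankMfree // -mxrank_tr trmx_mul trmxK.
by rewrite mxrankMfree // mxrank_tr mxrank_unit.
Qed.

(** Turns equalities of eigenspace dimensions into equalities of multiplicities in the list of
    diagonal entries. *)
Lemma rank_eigenspace_diag n (T V : 'M[C]_n) (d : 'rV_n) mu :
  V *m adjmx V = 1%:M -> T = adjmx V *m diag_mx d *m V ->
  \rank (kermx (T - mu%:M)^T) = #|[pred i | d 0 i == mu]|.
Proof.
move=> VV TE; have VV' := mulmx1C VV.
have -> : T - mu%:M = adjmx V *m diag_mx (d - const_mx mu) *m V.
  rewrite raddfB /= mulmxBr mulmxBl -TE diag_const_mx; congr (_ - _).
  by rewrite -scalemx1 -scalemxAr -scalemxAl mulmx1 VV'.
have [Vu Vu'] := mulmx1_unit VV.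
rewrite mxrank_ker mxrank_tr mxrankMfree ?row_free_unit //.
rewrite -mxrank_tr trmx_mul.
rewrite mxrankMfree ?row_free_unit ?(unitmx_tr (adjmx V)) //.
rewrite tr_diag_mx mxrank_diag -[X in (X - _)%N]card_ord.
rewrite -(cardC [pred i | d 0 i == mu]).
rewrite [X in (_ - X)%N](_ : _ = #|[predC [pred i | d 0 i == mu]]|) ?addnK //.
by apply: eq_card => i; rewrite !inE !mxE subr_eq0.
Qed.

Lemma hermitian_diag n (T : 'M[C]_n) : adjmx T = T ->
  exists (V : 'M[C]_n) (d : 'rV_n),
    [/\ V *m adjmx V = 1%:M, T = adjmx V *m diag_mx d *m V
      & forall i, d 0 i \is Num.real].
Proof.
move=> TT; have Tnormal : T \is normalmx.
  by apply/normalmxP; rewrite -map_trmx -/(adjmx T) TT.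
have /unitarymxP VV := spectral_unitarymx T.
rewrite -map_trmx -/(adjmx _) in VV.
have TE := orthomx_spectralP Tnormal.
rewrite (invmx_unitary (spectral_unitarymx T)) -map_trmx -/(adjmx _) in TE.
exists (spectralmx T), (spectral_diag T); split=> // i.
have : adjmx (diag_mx (spectral_diag T)) = diag_mx (spectral_diag T).
  have DE : diag_mx (spectral_diag T)
      = spectralmx T *m T *m adjmx (spectralmx T).
    by rewrite {3}TE !mulmxA VV mul1mx -mulmxA VV mulmx1.
  by rewrite DE !adjmxM adjmxK TT mulmxA.
move/matrixP/(_ i i); rewrite !mxE eqxx mulr1n => dR.
by apply/CrealP.
Qed.

(* The entries of [ds] come in pairs [x], [- x]; listing them from [a] on. *)
Lemma perm_eq_cat_opp (ds : seq C) a :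
  (forall x, x \in ds -> (x \is Num.real) && (x != 0)) ->
  (forall x, 0 < x -> count_mem x ds = count_mem (- x) ds) ->
  a \in ds -> 0 < a ->
  exists2 l, perm_eq ds ((a :: l) ++ map -%R (a :: l)) & all (> 0) (a :: l).
Proof.
move=> dsR dsC ads a0.
pose pos := [seq x <- ds | 0 < x].
have apos : a \in pos by rewrite mem_filter a0.
have posl := perm_to_rem apos.
exists (rem a pos); last by rewrite -(perm_all _ posl) filter_all.
have posl' : perm_eq (map -%R pos) (map -%R (a :: rem a pos)).
  exact: perm_map.
apply: perm_trans (perm_cat posl posl').
rewrite -(perm_filterC (> 0) ds) perm_cat2l.
(* The positive entries have been cancelled; the rest is compared with the negatives of [pos].
   Unless x < 0 both counts vanish, as 0 is not in [ds]; for x < 0 they are the multiplicities of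
   [x] and [- x] in [ds]. *)
apply/allP => x _ /=; apply/eqP; rewrite count_map !count_filter.
have [x0|x0] := boolP (x < 0); last first.
  rewrite (@eq_in_count _ _ pred0) ?(@eq_in_count _ _ pred0 ds) ?count_pred0 //.
    move=> y yds /=; case: eqP => //= yx.
    by apply: contraNF x0 => y0; rewrite -yx oppr_lt0.
  move=> y yds /=; case: eqP => //= yx; subst y.
  have /andP[xR xn0] := dsR _ yds.
  by apply: contraNF x0; rewrite -real_leNgt ?real0 // le_eqVlt (negPf xn0).
transitivity (count_mem x ds).
  apply: eq_in_count => y yds /=; case: eqP => //= ->.
  by rewrite -real_leNgt ?real0 ?ltW // ltr0_real.
rewrite -[in LHS](opprK x) -dsC ?oppr_gt0 //.
apply: eq_in_count => y yds /=; rewrite eqr_oppLR; case: eqP => //= ->.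
by rewrite oppr_gt0 x0.
Qed.

(** Reordering the entries is conjugation by a permutation matrix, which is unitary. *)
Lemma diag_mx_perm n (d e : 'rV[C]_n) :
  perm_eq [seq d 0 i | i <- enum 'I_n] [seq e 0 i | i <- enum 'I_n] ->
  exists2 V : 'M[C]_n, V *m adjmx V = 1%:M
    & diag_mx d = adjmx V *m diag_mx e *m V.
Proof.
have eE : [seq e 0 i | i <- enum 'I_n] = [tuple e 0 i | i < n] by [].
have dE : [seq d 0 i | i <- enum 'I_n] = [tuple d 0 i | i < n] by [].
rewrite eE => /tuple_permP[g]; rewrite dE => /val_inj de.
have {}de i : d 0 i = e 0 (g i).
  by have := congr1 (fun t => tnth t i) de; rewrite !tnth_mktuple.
have adjg : adjmx (perm_mx g^-1) = perm_mx g :> 'M[C]_n.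
  by rewrite /adjmx map_perm_mx tr_perm_mx invgK.
exists (perm_mx g^-1); first by rewrite adjg -perm_mxM mulVg perm_mx1.
rewrite adjg -row_permE -col_permE; apply/matrixP => i j; rewrite !mxE.
by rewrite (inj_eq perm_inj) de.
Qed.

End Conjugation.

(** * From the model to a general T *)

Definition defect_pair (C : numClosedFieldType) n (T U P : 'M[C]_n) : Prop :=
  [/\ U *m adjmx U = 1%:M, P *m P = P, adjmx P = P, irreducible_pair U P
    & 1%:M - P - U *m (1%:M - P) *m adjmx U = T].

Lemma defect_pair_conj (C : numClosedFieldType) n (T U P V : 'M[C]_n) :
  V *m adjmx V = 1%:M -> defect_pair T U P ->
  defect_pair (V *m T *m adjmx V) (V *m U *m adjmx V) (V *m P *m adjmx V).
Proof.
move=> VV [UU PP Psa irr defE]; have VV' := mulmx1C VV.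
have conjM (A B : 'M[C]_n) :
    V *m A *m adjmx V *m (V *m B *m adjmx V) = V *m (A *m B) *m adjmx V.
  by rewrite !mulmxA; congr (_ *m _ *m _); rewrite -!mulmxA VV' mulmx1.
have conj_adj (A : 'M[C]_n) :
    adjmx (V *m A *m adjmx V) = V *m adjmx A *m adjmx V.
  by rewrite !adjmxM adjmxK mulmxA.
have conj_perp : 1%:M - V *m P *m adjmx V = V *m (1%:M - P) *m adjmx V.
  by rewrite mulmxBr mulmx1 mulmxBl VV.
split.
- by rewrite conj_adj conjM UU mulmx1.
- by rewrite conjM PP.
- by rewrite conj_adj Psa.
- exact: irreducible_pair_conj.
by rewrite conj_perp conj_adj !conjM -mulmxBl -mulmxBr defE.
Qed.

Lemma model_defect_pair (C : numClosedFieldType) k (l : 'I_k.+1 -> C) :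
  (forall i, 0 < l i <= 1) -> l ord0 < 1 ->
  exists U P, defect_pair (diag_mx (row_mx (\row_i l i) (\row_i - l i))) U P.
Proof.
move=> l01 l0_lt1; have l_gt0 i : 0 < l i by case/andP: (l01 i).
pose s i := double_sin (l i).
have s_ge0 i : 0 <= s i by apply: double_sin_ge0.
have l_neq0 i : l i != 0 by rewrite gt_eqF.
have l_real i : l i \is Num.real by apply: gtr0_real.
have sl i : s i ^+ 2 + l i ^+ 2 = 1 by apply: double_sin_sq.
(* The bound l_0 < 1 enters here: it makes - s_0 nonzero, hence a simple eigenvalue of the
   compression. *)
have s0_gt0 : 0 < s ord0 by apply: double_sin_gt0; rewrite l_gt0.
pose c i := half_cos (l i); pose d i := half_sin (l i).
(* The change of basis from [q_i], [r_i] to the eigenvectors of [T]. *)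
pose G : 'M[C]_(k.+1 + k.+1) := block_mx (dmx c) (dmx d) (dmx d) (- dmx c).
have adjG : adjmx G = G.
  by rewrite /G adjmx_block adjmxN !adjmx_dmx // => i; apply: ger0_real;
     [apply: half_sin_ge0 | apply: half_cos_ge0].
have cd i : c i ^+ 2 + d i ^+ 2 = 1 by apply: cos_sin_half_sq.
have cBd i : l i = c i ^+ 2 - d i ^+ 2 by rewrite cosB_sin_half_sq.
have GG : G *m adjmx G = 1%:M.
  rewrite adjG /G mulmx_block [RHS]scalar_mx_block.
  rewrite !(mulmxN, mulNmx, opprK) !dmxM !dmxN !dmxD -dmx1 -dmx0.
  by congr block_mx; apply: dmx_eq => i /=; rewrite -?(cd i); ring.
pose U := model_U s l; pose P : 'M[C]_(k.+1 + k.+1) := 1%:M - model_Q C k.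
have UP : defect_pair (model_Q C k - U *m model_Q C k *m adjmx U) U P.
  have QQ : model_Q C k *m model_Q C k = model_Q C k.
    by rewrite mulmx_block !(mul0mx, mulmx0, addr0, mulmx1).
  split.
  - exact: model_unitary.
  - by rewrite /P mulmxBl mul1mx mulmxBr mulmx1 QQ subrr subr0.
  - by rewrite /P adjmxB adjmx1 adjmx_block adjmx1 !adjmx0.
  - exact: model_irreducible.
  by rewrite /P subKr.
have := defect_pair_conj GG UP; rewrite {1 2}adjG model_defect // => GUP.
(* With l_i = cos t, the defect in each plane is l_i times the reflection with rows (cos t, sin t)
   and (sin t, - cos t). Its eigenvectors for 1 and -1 are the columns (cos (t / 2), sin (t / 2))
   and (sin (t / 2), - cos (t / 2)) of [G]. *)
suff <- : G *m block_mx (dmx (fun i => l i ^+ 2)) (dmx (fun i => s i * l i))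
    (dmx (fun i => s i * l i)) (dmx (fun i => - l i ^+ 2)) *m G
    = diag_mx (row_mx (\row_i l i) (\row_i - l i)).
  by eexists; eexists; exact: GUP.
rewrite diag_mx_row -/(dmx l) -/(dmx (fun i => - l i)) /G !mulmx_block.
rewrite !(mulmxDl, mulmxDr, mulmxN, mulNmx, opprK) !dmxM !dmxN !dmxD -dmx0.
have sE i : s i = 2 * c i * d i by [].
(* By the double-angle formulas these say cos^2 + sin^2 = 1 and cos sin - sin cos = 0; multiplied by
   [l i], they give the four blocks below up to sign. *)
have A1 i : l i * (c i ^+ 2 - d i ^+ 2) + s i * (2 * c i * d i) = 1.
  by rewrite -cBd -sE -!expr2 addrC.
have A2 i : l i * (2 * c i * d i) - s i * (c i ^+ 2 - d i ^+ 2) = 0.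
  by rewrite -cBd -sE mulrC subrr.
congr block_mx; apply: dmx_eq => i /=.
- by rewrite -[RHS]mulr1 -(A1 i); ring.
- by rewrite -[RHS](mulr0 (l i)) -(A2 i); ring.
- by rewrite -[RHS](mulr0 (l i)) -(A2 i); ring.
by rewrite -[RHS]mulr1 -(A1 i); ring.
Qed.

Lemma nsq_gt0 (C : numClosedFieldType) n (v : 'cV[C]_n) :
  v != 0 -> 0 < (adjmx v *m v) 0 0.
Proof.
have term_ge0 i : 0 <= adjmx v 0 i * v i 0 by rewrite !mxE mulrC mul_conjC_ge0.
case/cV0Pn => i vi; rewrite mxE (bigD1 i) //= ltr_wpDr ?sumr_ge0 //.
by rewrite !mxE mulrC mul_conjC_gt0.
Qed.

Lemma contraction_eigenvalue (C : numClosedFieldType) n (T : 'M[C]_n) mu :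
  (forall v : 'cV_n, (adjmx (T *m v) *m (T *m v)) 0 0 <= (adjmx v *m v) 0 0) ->
  (exists2 v : 'cV_n, v != 0 & T *m v = mu *: v) -> `|mu| <= 1.
Proof.
move=> T1 [v v0 Tv]; have := T1 v; rewrite Tv.
have -> : (adjmx (mu *: v) *m (mu *: v)) 0 0 = `|mu| ^+ 2 * (adjmx v *m v) 0 0.
  rewrite normCK !mxE mulr_sumr; apply: eq_bigr => i _.
  by rewrite !mxE rmorphM /=; ring.
by rewrite ger_pMl ?nsq_gt0 // expr_le1.
Qed.

Lemma exists_defect_pair (C : numClosedFieldType) n (T : 'M[C]_n) :
  adjmx T = T ->
  (forall v : 'cV_n, T *m v = 0 -> v = 0) ->
  (forall v : 'cV_n, (adjmx (T *m v) *m (T *m v)) 0 0 <= (adjmx v *m v) 0 0) ->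
  (forall mu, 0 < mu <= 1 ->
     \rank (kermx (T - mu%:M)^T) = \rank (kermx (T - (- mu)%:M)^T)) ->
  (exists a b, [/\ 0 < a, 0 < b, a != b,
      exists2 v : 'cV_n, v != 0 & T *m v = a *: v
    & exists2 v : 'cV_n, v != 0 & T *m v = b *: v]) ->
  exists U P, defect_pair T U P.
Proof.
move=> Tsa Tinj T1 Tsym two_eig.
have eig_le1 mu : 0 < mu -> (exists2 v : 'cV_n, v != 0 & T *m v = mu *: v) ->
    mu <= 1.
  by move=> mu0 /(contraction_eigenvalue T1); rewrite gtr0_norm.
(* Of two distinct positive eigenvalues at most one is 1, and neither exceeds 1, so one lies
   strictly below 1. *)
have {two_eig} [a [a_gt0 a_lt1 Ta]] :
    exists a, [/\ 0 < a, a < 1 & exists2 v : 'cV_n, v != 0 & T *m v = a *: v].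
  have [a [b [a0 b0 ab Ta Tb]]] := two_eig.
  have [a1|a1] := eqVneq a 1; [exists b|exists a]; split=> //.
    by rewrite lt_neqAle eig_le1 // andbT eq_sym -a1.
  by rewrite lt_neqAle eig_le1 // a1.
have [V [d [VV TE d_real]]] := hermitian_diag Tsa.
have eigenE mu := diag_eigen mu VV TE.
have d_le1 i : `|d 0 i| <= 1.
  by apply: contraction_eigenvalue T1 _; apply/eigenE; exists i.
have d_neq0 i : d 0 i != 0.
  apply/eqP => di; have [v v0] : exists2 v : 'cV_n, v != 0 & T *m v = 0 *: v.
    by apply/eigenE; exists i.
  by rewrite scale0r => /Tinj /eqP; rewrite (negPf v0).
pose ds := [seq d 0 i | i <- enum 'I_n].
have countE mu : count_mem mu ds = #|[pred i | d 0 i == mu]|.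
  by rewrite count_map cardE -size_filter enumT.
have dsP x : x \in ds -> exists i, x = d 0 i by case/mapP => i _ ->; exists i.
have [||||l dsl l_gt0] := @perm_eq_cat_opp C ds a.
- by move=> _ /dsP[i ->]; rewrite d_real d_neq0.
(* Up to 1 the multiplicities are eigenspace dimensions; beyond 1 both are zero because T is a
   contraction. *)
- move=> x x_gt0; rewrite !countE; have [x_le1|x_gt1] := boolP (x <= 1).
    by rewrite -!(rank_eigenspace_diag _ VV TE) Tsym ?x_gt0.
  rewrite !eq_card0 // => i; rewrite !inE; apply: contraNF x_gt1 => /eqP xE.
    by have := d_le1 i; rewrite xE normrN gtr0_norm.
  by have := d_le1 i; rewrite xE gtr0_norm.
- by have /eigenE[i <-] := Ta; apply: map_f; rewrite mem_enum.
- exact: a_gt0.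
have size_n : n = (size l).+1 + (size l).+1.
  by have := perm_size dsl; rewrite size_map size_enum_ord size_cat size_map.
have [k kE] : exists k, size l = k by exists (size l).
rewrite kE in size_n; subst n.
have szl : size (a :: l) = k.+1 by rewrite /= kE.
(* The head of the list is [a], so [lam ord0 < 1] as the model requires. The list has length [k.+1],
   so the default 0 is never returned. *)
pose lam (i : 'I_k.+1) := nth 0 (a :: l) i.
have lam_l (i : 'I_k.+1) : lam i \in a :: l by rewrite mem_nth //= kE.
have lam_gt0 i : 0 < lam i by apply: (allP l_gt0).
have lam_le1 i : lam i <= 1.
  have /dsP[j ->] : lam i \in ds by rewrite (perm_mem dsl) mem_cat lam_l.
  exact: le_trans (real_ler_norm _) (d_le1 j).
have [||U [P UP]] := @model_defect_pair C k lam.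
- by move=> i; rewrite lam_gt0 lam_le1.
- exact: a_lt1.
have [|W WW dE] := @diag_mx_perm C _ d (row_mx (\row_i lam i) (\row_i - lam i)).
  suff -> : [seq row_mx (\row_i lam i) (\row_i - lam i) 0 i
              | i <- enum 'I_(k.+1 + k.+1)]
      = (a :: l) ++ map -%R (a :: l) by [].
  apply: (@eq_from_nth _ 0).
    by rewrite size_map size_enum_ord size_cat size_map /= kE.
  move=> i; rewrite size_map size_enum_ord => ilt.
  rewrite (nth_map (Ordinal ilt)) ?size_enum_ord // nth_cat.
  have -> : nth (Ordinal ilt) (enum 'I_(k.+1 + k.+1)) i = Ordinal ilt.
    by apply: val_inj; rewrite /= nth_enum_ord.
  rewrite mxE; case: splitP => j ij; rewrite mxE /lam.
    have {ij}-> : i = j by [].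
    by rewrite szl ltn_ord.
  have {ij}-> : i = (k.+1 + j)%N by [].
  rewrite szl ifF; last by rewrite ltnNge leq_addr.
  by rewrite addKn (nth_map 0) // szl.
(* T is diagonalised by V and its entries are reordered by W, so V^* W^* carries the model defect to
   T. *)
have WV : adjmx V *m adjmx W *m adjmx (adjmx V *m adjmx W) = 1%:M.
  rewrite adjmxM !adjmxK mulmxA -[X in X *m _]mulmxA.
  by rewrite (mulmx1C WW) mulmx1 (mulmx1C VV).
have := defect_pair_conj WV UP.
rewrite {1 2}adjmxM !adjmxK.
have -> : adjmx V *m adjmx W *m diag_mx (row_mx (\row_i lam i) (\row_i - lam i))
    *m (W *m V) = T by rewrite TE dE !mulmxA.
by move=> ?; eexists; eexists; eassumption.
Qed.

Theorem theorem3p2 (R : realType) (n : nat) (T : 'M[R[i]]_n) :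
  defect_form T ->
  Edim T 1 = Edim T (-1) ->
  (exists a b : R[i], [/\ 0 < a, 0 < b, a != b, is_eigenvalue T a
                        & is_eigenvalue T b]) ->
  exists U P : 'M[R[i]]_n,
    [/\ unitary_mx U, orth_projection P, no_common_reducing U P
      & perp P - U *m perp P *m adj U = T].
Proof.
move=> [Tsa Tinj T1 Tsym] Tsym1 two_eig.
(* The symmetry of the defect form on (0,1) and the assumption at 1 combine into symmetry on
   (0,1]. *)
have Tsym' mu : 0 < mu <= 1 -> Edim T mu = Edim T (- mu).
  case/andP=> mu0; rewrite le_eqVlt => /orP[/eqP->|mu1]; first exact: Tsym1.
  have mu01 : 0 < mu < 1 by apply/andP.
  exact: (Tsym mu mu01).2.
have [U [P [UU PP Psa irr defE]]] :=
  exists_defect_pair Tsa Tinj T1 Tsym' two_eig.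
(* At [R[i]], [adjmx] is convertible with [adj], so the components of [defect_pair] apply
   directly. *)
exists U, P; split.
- exact: conj UU (mulmx1C UU).
- exact: conj PP Psa.
- move=> W /andP[sU sU'] /andP[sP sP'].
  have [W0|W1] := irr W (And4 sU sU' sP sP'); apply/orP; [left|right].
    by rewrite W0 submx_refl.
  by rewrite submx1 W1.
exact: defE.
Qed.
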